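(* Let $K$ be a field with $\mathrm{char}(K)\neq 2$ and let $E$ be an elliptic curve over $K$. The following are equivalent: (i) $E(K)$ contains a subgroup isomorphic to $\mathbb{Z}/10\mathbb{Z}\oplus\mathbb{Z}/2\mathbb{Z}$; (ii) there exist $a_1,a_2,a_3\in K$ such that $\pm a_1,\pm a_2,\pm a_3$ are six distinct elements of $K$; none of $\beta_1=-a_1^2+a_2^2+a_3^2$, $\beta_2=a_1^2-a_2^2+a_3^2$, $\beta_3=a_1^2+a_2^2-a_3^2$ vanishes; $$a_1^3+a_2^3+a_3^3-a_1^2a_2-a_1a_2^2-a_2^2a_3-a_2a_3^2-a_1^2a_3-a_1a_3^2-2a_1a_2a_3=0;$$ $$(a_1+a_2+a_3)(a_1-a_2-a_3)(a_1+a_2-a_3)(a_1-a_2+a_3)\neq0;$$ and $E$ is isomorphic (over $K$) to the elliptic curve $E_{5;a_1,a_2,a_3}: y^2=\left(x+\frac{\beta_1^2}{4}\right)\left(x+\frac{\beta_2^2}{4}\right)\left(x+\frac{\beta_3^2}{4}\right)$. *)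

(* Defs.v *)
From HB Require Import structures.
From mathcomp Require Import all_boot all_order all_algebra.
From mathcomp Require Import ring.

Set Implicit Arguments.
Unset Strict Implicit.
Unset Printing Implicit Defensive.

Import GRing.Theory.
Local Open Scope ring_scope.

(* y^2 + c1 x y + c3 y = x^3 + c2 x^2 + c4 x + c6, over an arbitrary field, so
   that characteristics 2 and 3 need no separate treatment. *)
Record weierstrass (K : fieldType) := Weierstrass {
  c1 : K; c2 : K; c3 : K; c4 : K; c6 : K
}.

Definition discriminant (K : fieldType) (W : weierstrass K) : K :=
  let b2 := c1 W ^+ 2 + 4 * c2 W in
  let b4 := 2 * c4 W + c1 W * c3 W in
  let b6 := c3 W ^+ 2 + 4 * c6 W in
  let b8 := c1 W ^+ 2 * c6 W + 4 * c2 W * c6 W - c1 W * c3 W * c4 W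
            + c2 W * c3 W ^+ 2 - c4 W ^+ 2 in
  - b2 ^+ 2 * b8 - 8 * b4 ^+ 3 - 27 * b6 ^+ 2 + 9 * b2 * b4 * b6.

Record ellipticCurve (K : fieldType) := EllipticCurve {
  model :> weierstrass K;
  discriminant_neq0 : discriminant model != 0
}.

(* The isomorphisms over K of Weierstrass curves fixing the point at infinity:
   there are u in K^* and r, s, t in K such that the substitution
   x = u^2 x' + r, y = u^3 y' + u^2 s x' + t turns the equation of W into
   u^6 times the equation of W'. *)
Definition isomorphic (K : fieldType) (W W' : weierstrass K) : Prop :=
  exists u r s t : K, u != 0 /\
  [/\ u * c1 W' = c1 W + 2 * s,
      u ^+ 2 * c2 W' = c2 W - s * c1 W + 3 * r - s ^+ 2,
      u ^+ 3 * c3 W' = c3 W + r * c1 W + 2 * t,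
      u ^+ 4 * c4 W' = c4 W - s * c3 W + 2 * r * c2 W - (t + r * s) * c1 W
                       + 3 * r ^+ 2 - 2 * s * t
    & u ^+ 6 * c6 W' = c6 W + r * c4 W + r ^+ 2 * c2 W + r ^+ 3 - t * c3 W
                       - t ^+ 2 - r * t * c1 W].

(* [None] is the point at infinity. *)
Definition on_curve (K : fieldType) (W : weierstrass K) (P : option (K * K)) :=
  if P is Some (x, y) then
    y ^+ 2 + c1 W * x * y + c3 W * y == x ^+ 3 + c2 W * x ^+ 2 + c4 W * x + c6 W
  else true.

Definition opp_raw (K : fieldType) (W : weierstrass K) (P : option (K * K)) :=
  if P is Some (x, y) then Some (x, - y - c1 W * x - c3 W) else None.

(* Chord-and-tangent law; [l] is the slope of the chord, or of the tangent when
   the two points coincide. *)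
Definition add_raw (K : fieldType) (W : weierstrass K) (P Q : option (K * K)) :=
  match P, Q with
  | None, _ => Q
  | _, None => P
  | Some (x1, y1), Some (x2, y2) =>
    if (x1 == x2) && (y2 == - y1 - c1 W * x1 - c3 W) then None else
    let l := if x1 == x2
             then (3 * x1 ^+ 2 + 2 * c2 W * x1 + c4 W - c1 W * y1)
                  / (2 * y1 + c1 W * x1 + c3 W)
             else (y2 - y1) / (x2 - x1) in
    let x3 := l ^+ 2 + c1 W * l - c2 W - x1 - x2 in
    Some (x3, - (y1 + l * (x3 - x1)) - c1 W * x3 - c3 W)
  end.

Lemma opp_raw_on_curve (K : fieldType) (W : weierstrass K) P :
  on_curve W P -> on_curve W (opp_raw W P).
Proof.
by case: P => [[x y]|] //= /eqP <-; apply/eqP; ring.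
Qed.

Lemma add_raw_on_curve (K : fieldType) (W : weierstrass K) P Q :
  on_curve W P -> on_curve W Q -> on_curve W (add_raw W P Q).
Proof.
case: P Q => [[x1 y1]|] [[x2 y2]|] //; rewrite /add_raw.
case: W => a1 a2 a3 a4 a6 /=.
move=> /eqP h1 /eqP h2.
case: (eqVneq x1 x2) => [e|x12] /=; last first.
  have d0 : x2 - x1 != 0 by rewrite subr_eq0 eq_sym.
  set l := (y2 - y1) / (x2 - x1).
  have y2E : y2 = y1 + l * (x2 - x1) by rewrite /l divfK //; ring.
  move: l y2E => l y2E; subst y2; apply/eqP/(mulfI d0)/eqP.
  rewrite -subr_eq0; set x3 := l ^+ 2 + _ - _ - _ - _; apply/eqP.
  pose D1 := y1 ^+ 2 + a1 * x1 * y1 + a3 * y1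
             - (x1 ^+ 3 + a2 * x1 ^+ 2 + a4 * x1 + a6).
  pose y2 := y1 + l * (x2 - x1).
  pose D2 := y2 ^+ 2 + a1 * x2 * y2 + a3 * y2
             - (x2 ^+ 3 + a2 * x2 ^+ 2 + a4 * x2 + a6).
  have E1 : D1 = 0 by rewrite /D1 h1 subrr.
  have E2 : D2 = 0 by rewrite /D2 /y2 h2 subrr.
  transitivity ((x2 - x3) * D1 + (x3 - x1) * D2); last by rewrite E1 E2; ring.
  by rewrite /D1 /D2 /y2 /x3; ring.
subst x2; case: ifP => [//|/negbT y2N].
have y12 : y1 = y2.
  apply/eqP; move: y2N; apply: contraNT => ne.
  rewrite -subr_eq0; have /mulfI inj : y1 - y2 != 0 by rewrite subr_eq0.
  apply/eqP/inj; rewrite mulr0; transitivity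
    ((y1 ^+ 2 + a1 * x1 * y1 + a3 * y1) - (y2 ^+ 2 + a1 * x1 * y2 + a3 * y2)).
    by ring.
  by rewrite h1 h2 subrr.
subst y2.
have d0 : 2 * y1 + a1 * x1 + a3 != 0.
  apply: contraNneq y2N => e; apply/eqP.
  by apply/eqP; rewrite -subr_eq0 -e; apply/eqP; ring.
rewrite /=; set l := _ / _.
have lE : l * (2 * y1 + a1 * x1 + a3)
          = 3 * x1 ^+ 2 + 2 * a2 * x1 + a4 - a1 * y1 by rewrite /l divfK.
move: l lE => l lE.
set x3 := l ^+ 2 + _ - _ - _ - _; rewrite -subr_eq0; apply/eqP.
pose D1 := y1 ^+ 2 + a1 * x1 * y1 + a3 * y1
           - (x1 ^+ 3 + a2 * x1 ^+ 2 + a4 * x1 + a6).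
pose D2 := l * (2 * y1 + a1 * x1 + a3)
           - (3 * x1 ^+ 2 + 2 * a2 * x1 + a4 - a1 * y1).
have E1 : D1 = 0 by rewrite /D1 h1 subrr.
have E2 : D2 = 0 by rewrite /D2 lE subrr.
transitivity (D1 + (x3 - x1) * D2); last by rewrite E1 E2; ring.
by rewrite /D1 /D2 /x3; ring.
Qed.

Record point (K : fieldType) (W : weierstrass K) := Point {
  coords :> option (K * K);
  coordsP : on_curve W coords
}.

HB.instance Definition _ (K : fieldType) (W : weierstrass K) :=
  [isSub for @coords K W].
HB.instance Definition _ (K : fieldType) (W : weierstrass K) :=
  [Equality of point W by <:].

Section GroupLaw.
Variables (K : fieldType) (E : ellipticCurve K).

Definition zero_pt : point E := @Point K E None isT.
Definition opp_pt (P : point E) : point E :=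
  Point (opp_raw_on_curve (coordsP P)).
Definition add_pt (P Q : point E) : point E :=
  Point (add_raw_on_curve (coordsP P) (coordsP Q)).

Definition is_subgroup (H : point E -> Prop) : Prop :=
  [/\ H zero_pt,
      forall P Q, H P -> H Q -> H (add_pt P Q)
    & forall P, H P -> H (opp_pt P)].

Definition contains_subgroup_isomorphic_to (G : zmodType) : Prop :=
  exists2 H : point E -> Prop, is_subgroup H &
  exists f : G -> point E,
    [/\ injective f,
        forall P, H P <-> exists g, f g = P
      & forall g h, f (g + h) = add_pt (f g) (f h)].

End GroupLaw.

(* y^2 = (x + e1) (x + e2) (x + e3) *)
Definition cubic_model (K : fieldType) (e1 e2 e3 : K) : weierstrass K :=
  Weierstrass 0 (e1 + e2 + e3) 0 (e1 * e2 + e1 * e3 + e2 * e3) (e1 * e2 * e3).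

Lemma on_curve_cubic_model (K : fieldType) (e1 e2 e3 x y : K) :
  on_curve (cubic_model e1 e2 e3) (Some (x, y)) =
  (y ^+ 2 == (x + e1) * (x + e2) * (x + e3)).
Proof. by rewrite /on_curve /=; congr (_ == _); ring. Qed.

Section Beta.
Variables (K : fieldType) (a1 a2 a3 : K).

Definition beta1 := - a1 ^+ 2 + a2 ^+ 2 + a3 ^+ 2.
Definition beta2 := a1 ^+ 2 - a2 ^+ 2 + a3 ^+ 2.
Definition beta3 := a1 ^+ 2 + a2 ^+ 2 - a3 ^+ 2.

Definition E5 := cubic_model (beta1 ^+ 2 / 4) (beta2 ^+ 2 / 4) (beta3 ^+ 2 / 4).

Lemma discriminant_E5_neq0 :
  2%N \notin [pchar K] -> uniq [:: a1; - a1; a2; - a2; a3; - a3] ->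
  discriminant E5 != 0.
Proof.
move=> ch; rewrite /= !inE !negb_or.
case/andP=> /and5P[n1 d12 d12' d13 d13'].
case/andP=> _ /andP[/and3P[n2 d23 d23'] /andP[_ /andP[n3 _]]].
have two0 : (2 : K) != 0 by apply: contraNneq ch => e; rewrite inE /= e eqxx.
have four0 : (4 : K) != 0.
  by rewrite (_ : 4 = 2 * 2) ?mulf_neq0 //; ring.
have nz (a : K) : a != - a -> a != 0.
  by apply: contraNneq => ->; rewrite oppr0.
have -> : discriminant E5 =
  (2 ^+ 2 * (a1 * a2 * a3) ^+ 2 * ((a1 - a2) * (a1 + a2))
    * ((a1 - a3) * (a1 + a3)) * ((a2 - a3) * (a2 + a3))) ^+ 2.
  by rewrite /discriminant /E5 /beta1 /beta2 /beta3 /=; field; rewrite ?four0 ?two0.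
rewrite !(expf_neq0, mulf_neq0) ?two0 ?(nz a1) ?(nz a2) ?(nz a3) //.
all: by rewrite ?subr_eq0 ?addr_eq0.
Qed.

End Beta.

(* Main.v *)
Require Import Defs.
From mathcomp Require Import all_boot all_order all_algebra.
From mathcomp Require Import ring.

Set Implicit Arguments.
Unset Strict Implicit.
Unset Printing Implicit Defensive.

Import GRing.Theory.
Local Open Scope ring_scope.

(* If 2 (x, y) = (x', y') on y^2 = (x + e1) (x + e2) (x + e3), then the x' + e_i
   are squares r_i^2, with x = x' + r1 r2 + r1 r3 + r2 r3,
   y = (r1 + r2) (r1 + r3) (r2 + r3) and y' = r1 r2 r3; conversely such r_i
   give a half of (x', y').
   A curve with full 2-torsion and a point R of order 5 has R -> Q = 2 R ->
   2 Q = - R, and these two doublings give s_i with x(Q) + e_i = s_i^2 and r_i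
   with x(R) + e_i = r_i^2.  Then s_k^2 = (r_i + r_k) (r_j + r_k), so after
   scaling by d = y(Q) each d (r_i + r_j) is the square of a_k = s_i s_j, that
   is, d r_i = beta_i / 2; and x(R) - x(Q) computed in the two ways gives the
   relation (a1 + a2 + a3) * cubic = 0.
   Conversely the a_i provide R and Q with 2 R = Q and 2 Q = - R.  No
   associativity of the group law is needed beyond (P + T) + Q = (P + Q) + T for
   T of order 2, where P -> P + T is (x, y) -> (b / x, - b y / x^2) on
   y^2 = x (x^2 + a x + b). *)

(** * Changes of variables, and embeddings of a group into raw coordinates *)

Section Isomorphism.
Variable K : fieldType.
Implicit Types (W : weierstrass K) (P Q : option (K * K)).

(** The difference of the two equations factors as [z - y] times [z - (- y - c1 W * x - c3 W)]. The
    second conclusion is the nonvanishing of the denominator of the tangent slope. *)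
Lemma on_curve_same_abscissa W (x y z : K) :
  on_curve W (Some (x, y)) -> on_curve W (Some (x, z)) ->
  z != - y - c1 W * x - c3 W -> z = y /\ 2 * y + c1 W * x + c3 W != 0.
Proof.
rewrite /on_curve => /eqP hy /eqP hz nz.
have zy : z = y.
  have ne : z - (- y - c1 W * x - c3 W) != 0 by rewrite subr_eq0.
  apply/eqP; rewrite -subr_eq0; apply/eqP/(mulfI ne); rewrite mulr0.
  transitivity ((z ^+ 2 + c1 W * x * z + c3 W * z) -
    (y ^+ 2 + c1 W * x * y + c3 W * y)); first by ring.
  by rewrite hy hz subrr.
split=> //; move: nz; rewrite zy -subr_eq0; congr (_ != 0); ring.
Qed.

(** Goes from points of [W'] to points of [W], like the substitution in [isomorphic]. *)
Definition change_vars (u r s t : K) P :=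
  if P is Some (x, y) then
    Some (u ^+ 2 * x + r, u ^+ 3 * y + u ^+ 2 * s * x + t)
  else None.

Definition unchange_vars (u r s t : K) P :=
  if P is Some (x, y) then
    Some ((x - r) / u ^+ 2, (y - s * (x - r) - t) / u ^+ 3)
  else None.

Definition is_change (u r s t : K) W W' :=
  [/\ u * c1 W' = c1 W + 2 * s,
      u ^+ 2 * c2 W' = c2 W - s * c1 W + 3 * r - s ^+ 2,
      u ^+ 3 * c3 W' = c3 W + r * c1 W + 2 * t,
      u ^+ 4 * c4 W' = c4 W - s * c3 W + 2 * r * c2 W - (t + r * s) * c1 W
                       + 3 * r ^+ 2 - 2 * s * t
    & u ^+ 6 * c6 W' = c6 W + r * c4 W + r ^+ 2 * c2 W + r ^+ 3 - t * c3 W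
                       - t ^+ 2 - r * t * c1 W].

(** The five equations are triangular in the coefficients of [W]. Rewriting with the solution
    eliminates [W] and leaves identities for [ring]. *)
Lemma is_changeE u r s t W W' : is_change u r s t W W' ->
  let d1 := u * c1 W' - 2 * s in
  let d2 := u ^+ 2 * c2 W' + s * d1 - 3 * r + s ^+ 2 in
  let d3 := u ^+ 3 * c3 W' - r * d1 - 2 * t in
  let d4 := u ^+ 4 * c4 W' + s * d3 - 2 * r * d2 + (t + r * s) * d1
            - 3 * r ^+ 2 + 2 * s * t in
  W = Weierstrass d1 d2 d3 d4
    (u ^+ 6 * c6 W' - r * d4 - r ^+ 2 * d2 - r ^+ 3 + t * d3
      + t ^+ 2 + r * t * d1).
Proof.
case: W => w1 w2 w3 w4 w6 [/= -> -> -> -> ->]; congr Weierstrass; ring.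
Qed.

Lemma isomorphic_trans W1 W2 W3 :
  isomorphic W1 W2 -> isomorphic W2 W3 -> isomorphic W1 W3.
Proof.
move=> [u [r [s [t [u0 ch]]]]] [v [r' [s' [t' [v0 ch']]]]].
(* The coefficients of the composite of the two substitutions. *)
exists (u * v), (u ^+ 2 * r' + r), (u * s' + s).
exists (u ^+ 3 * t' + u ^+ 2 * s * r' + t); split; first exact: mulf_neq0.
rewrite (is_changeE ch) (is_changeE ch').
by case: W3 ch' => w1 w2 w3 w4 w6 _; split=> /=; ring.
Qed.

Section Change.
Variables (u r s t : K) (W W' : weierstrass K).
Hypotheses (u0 : u != 0) (ch : is_change u r s t W W').

Local Notation phi := (change_vars u r s t).
Local Notation psi := (unchange_vars u r s t).

Lemma change_varsK : cancel phi psi.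
Proof. by case=> [[x y]|] //=; congr (Some (_, _)); field. Qed.

Lemma unchange_varsK : cancel psi phi.
Proof. by case=> [[x y]|] //=; congr (Some (_, _)); field. Qed.

Lemma on_curve_change P : on_curve W (phi P) = on_curve W' P.
Proof.
rewrite (is_changeE ch); case: P => [[x y]|] //=.
rewrite -subr_eq0 -[RHS]subr_eq0.
rewrite -[RHS](inj_eq (mulfI (expf_neq0 6 u0))) mulr0; congr (_ == 0); ring.
Qed.

(** A line of slope l on [W'] becomes a line of slope u l + s on [W]; once this is checked for
    chords and for tangents, both coordinates agree by a polynomial identity. *)
Lemma add_change P Q : on_curve W' P -> on_curve W' Q ->
  phi (add_raw W' P Q) = add_raw W (phi P) (phi Q).
Proof.
rewrite (is_changeE ch).
case: P Q => [[x1 y1]|] [[x2 y2]|] // oP oQ.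
have u2 := expf_neq0 2 u0; have u3 := expf_neq0 3 u0.
rewrite /add_raw [phi (Some (x1, _))]/= [phi (Some (x2, _))]/=.
have -> : (u ^+ 2 * x1 + r == u ^+ 2 * x2 + r) = (x1 == x2).
  by rewrite (inj_eq (addIr r)) (inj_eq (mulfI u2)).
case: (eqVneq x1 x2) => [x12 | x12] /=; last first.
  have dx : x2 - x1 != 0 by rewrite subr_eq0 eq_sym.
  have -> : (u ^+ 3 * y2 + u ^+ 2 * s * x2 + t -
     (u ^+ 3 * y1 + u ^+ 2 * s * x1 + t)) / (u ^+ 2 * x2 + r - (u ^+ 2 * x1 + r))
     = u * ((y2 - y1) / (x2 - x1)) + s.
    field; rewrite dx.
    have -> : u ^+ 2 * x2 + r - (u ^+ 2 * x1 + r) = u ^+ 2 * (x2 - x1) by ring.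
    exact: mulf_neq0.
  by congr (Some (_, _)); ring.
subst x2; rewrite /=.
set lhs := (_ == _); set rhs := (_ == _).
have -> : rhs = lhs.
  rewrite /rhs /lhs -subr_eq0 -[RHS]subr_eq0.
  rewrite -[RHS](inj_eq (mulfI u3)) mulr0; congr (_ == 0); ring.
case: ifP => // /negbT nlhs.
have [y12 d0] := on_curve_same_abscissa oP oQ nlhs.
have -> : (u * c1 W' - 2 * s) * (u ^+ 2 * x1 + r) = 
   u ^+ 3 * (c1 W' * x1) + u * c1 W' * r - 2 * s * (u ^+ 2 * x1 + r) by ring.
set D := _ + (u ^+ 3 * c3 W' - _ - _).
have -> : D = u ^+ 3 * (2 * y1 + c1 W' * x1 + c3 W') by rewrite /D; ring.
set N := 3 * x1 ^+ 2 + _ + _ - _.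
set M := 3 * _ ^+ 2 + _ + _ - _.
set d := 2 * y1 + c1 W' * x1 + c3 W'.
have -> : M = u ^+ 4 * N + u ^+ 3 * s * d by rewrite /M /N /d; ring.
have -> : (u ^+ 4 * N + u ^+ 3 * s * d) / (u ^+ 3 * d) = u * (N / d) + s.
  by field; rewrite d0 u0.
by congr (Some (_, _)); ring.
Qed.

End Change.

(** Stated on raw coordinates over a bare [weierstrass] record, so that intermediate models carry
    neither membership proofs nor a discriminant condition. *)
Definition embedding W (G : zmodType) (f : G -> option (K * K)) :=
  [/\ injective f, forall g, on_curve W (f g)
    & forall g h, f (g + h) = add_raw W (f g) (f h)].

Lemma embedding_isomorphic W W' (G : zmodType) : isomorphic W W' ->
  (exists f : G -> _, embedding W f) <-> (exists f : G -> _, embedding W' f).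
Proof.
move=> [u [r [s [t [u0 ch]]]]]; set phi := change_vars u r s t.
have phiK := change_varsK r s t u0; have psiK := unchange_varsK r s t u0.
split=> -[f [finj fon fadd]].
  exists (unchange_vars u r s t \o f).
  have on g : on_curve W' ((unchange_vars u r s t \o f) g).
    by rewrite -(on_curve_change u0 ch) /= psiK.
  split=> //; first exact/inj_comp/finj/(can_inj psiK).
  move=> g h; apply: (can_inj phiK); rewrite [RHS](add_change u0 ch (on g) (on h)).
  by rewrite /= !psiK.
exists (phi \o f); split; first exact/inj_comp/finj/(can_inj phiK).
  by move=> g; rewrite /= (on_curve_change u0 ch).
by move=> g h; rewrite /= fadd; exact: (add_change u0 ch).
Qed.

Lemma add_raw_eq_None W P Q : add_raw W P Q = None -> Q = opp_raw W P.
Proof.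
case: P Q => [[x1 y1]|] [[x2 y2]|] //=.
by case: ifP => // /andP[/eqP -> /eqP ->].
Qed.

(** Stands in for cancellation when proving [f 0 = None]. If an affine P satisfies P + P = P,
    comparing ordinates gives P = - P, and then P + P is [None]. *)
Lemma add_raw_idem W P : add_raw W P P = P -> P = None.
Proof.
case: P => [[x y]|] //=; rewrite eqxx /=; case: ifP => // /eqP ne [ex].
by rewrite ex => ey; case: ne; rewrite -[LHS]ey; ring.
Qed.

Lemma embedding0 W (G : zmodType) (f : G -> _) : embedding W f -> f 0 = None.
Proof. by case=> _ _ fadd; apply: (@add_raw_idem W); rewrite -fadd addr0. Qed.

Lemma embeddingN W (G : zmodType) (f : G -> _) (g : G) :
  embedding W f -> f (- g) = opp_raw W (f g).
Proof.
move=> emb; apply: add_raw_eq_None; case: (emb) => _ _ <-.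
by rewrite subrr (embedding0 emb).
Qed.

(** Conversely, the subgroup is taken to be the image of [f]. *)
Lemma contains_subgroupP (E : ellipticCurve K) (G : zmodType) :
  contains_subgroup_isomorphic_to E G <-> exists f : G -> _, embedding E f.
Proof.
split=> [[H subH [f [finj fH fadd]]] | [f emb]].
  exists (fun g => coords (f g)); split=> [g h /val_inj/finj // | g | g h].
    exact: coordsP.
  by rewrite fadd.
have [finj fon fadd] := emb.
pose F g := Point (fon g).
exists (fun p => exists g, F g = p); last first.
  exists F; split=> // [g h /(congr1 val)/finj // | g h].
  exact/val_inj/fadd.
split; first by exists 0; apply/val_inj/(embedding0 emb).
  by move=> _ _ [g <-] [h <-]; exists (g + h); apply/val_inj/fadd.
by move=> _ [g <-]; exists (- g); apply/val_inj/(embeddingN _ emb).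
Qed.

End Isomorphism.

(** * Collinear triples on y^2 = x^3 + a x^2 + b x + c *)

Section Lines.
Variables (K : fieldType) (a b c : K).

Local Notation W := (Weierstrass 0 a 0 b c).
Implicit Types x y l m : K.

(** A singular point has y = 0 when 2 is invertible, so this excludes singular points over [K]. *)
Definition nonsingular :=
  forall x, x ^+ 3 + a * x ^+ 2 + b * x + c = 0 ->
    3 * x ^+ 2 + 2 * a * x + b != 0.

(* [y = l x + m] meets the curve in the three points, with multiplicity:
   [x^3 + a x^2 + b x + c - (l x + m)^2 = (x - x1) (x - x2) (x - x3)]. *)
Definition collinear x1 y1 x2 y2 x3 y3 := exists l m,
  [/\ y1 = l * x1 + m, y2 = l * x2 + m & y3 = l * x3 + m] /\
  [/\ a = l ^+ 2 - (x1 + x2 + x3),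
      b = 2 * l * m + x1 * x2 + x1 * x3 + x2 * x3
    & c = m ^+ 2 - x1 * x2 * x3].

Lemma collinear_swap x1 y1 x2 y2 x3 y3 :
  collinear x1 y1 x2 y2 x3 y3 -> collinear x2 y2 x1 y1 x3 y3.
Proof.
move=> [l [m [[-> -> ->] [ea eb ec]]]]; exists l, m.
by split; split=> //; rewrite ?ea ?eb ?ec; ring.
Qed.

Lemma collinear_rot x1 y1 x2 y2 x3 y3 :
  collinear x1 y1 x2 y2 x3 y3 -> collinear x2 y2 x3 y3 x1 y1.
Proof.
move=> [l [m [[-> -> ->] [ea eb ec]]]]; exists l, m.
by split; split=> //; rewrite ?ea ?eb ?ec; ring.
Qed.

Lemma collinear_opp x1 y1 x2 y2 x3 y3 :
  collinear x1 y1 x2 y2 x3 y3 -> collinear x1 (- y1) x2 (- y2) x3 (- y3).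
Proof.
move=> [l [m [[-> -> ->] [ea eb ec]]]]; exists (- l), (- m).
by split; split=> //; rewrite ?ea ?eb ?ec; ring.
Qed.

Lemma collinear_add x1 y1 x2 y2 x3 y3 :
  (2 : K) != 0 -> nonsingular -> collinear x1 y1 x2 y2 x3 y3 ->
  add_raw W (Some (x1, y1)) (Some (x2, y2)) = Some (x3, - y3).
Proof.
move=> two0 ns [l [m [[e1 e2 e3] [ea eb ec]]]].
have x3E : x3 = l ^+ 2 - a - x1 - x2 by rewrite ea; ring.
rewrite /add_raw /=; case: (eqVneq x1 x2) => [x12 | x12] /=; last first.
  have dx : x2 - x1 != 0 by rewrite subr_eq0 eq_sym.
  have -> : (y2 - y1) / (x2 - x1) = l by rewrite e1 e2; field.
  rewrite e3 x3E e1; congr (Some (_, _)); ring.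
have y12 : y2 = y1 by rewrite e2 -x12 -e1.
(* Here [x1] is a double root of the cubic minus (l x + m)^2, so the derivative of the cubic at [x1]
   is 2 l y1. If [y1] were zero, [x1] would be a double root of the cubic. *)
have y0 : y1 != 0.
  apply/negP => /eqP y0; have /ns/negP[] : x1 ^+ 3 + a * x1 ^+ 2 + b * x1 + c = 0.
    transitivity (y1 ^+ 2); last by rewrite y0 expr0n.
    rewrite e1 ea eb ec; ring.
  apply/eqP; transitivity (2 * l * y1); last by rewrite y0 mulr0.
  by rewrite e1 ea eb -x12; ring.
have yy : 2 * y1 != 0 by rewrite mulf_neq0.
rewrite y12 !mul0r !addr0 !subr0 ifF; last first.
  apply/negP => /eqP h; case/negP: yy; apply/eqP.
  by rewrite mulr_natl mulr2n {1}h addNr.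
have -> : (3 * x1 ^+ 2 + 2 * a * x1 + b) / (2 * y1) = l.
  apply: (mulIf yy); rewrite divfK // e1 ea eb -x12; ring.
rewrite e3 x3E e1; congr (Some (_, _)); ring.
Qed.

(** The line is the one used by [add_raw]. The coefficient [b] is recovered from the difference of
    the two curve equations for a chord, or from the slope formula for a tangent; then [c] comes
    from the first equation. *)
Lemma add_collinear x1 y1 x2 y2 x3 y3 :
  on_curve W (Some (x1, y1)) -> on_curve W (Some (x2, y2)) ->
  add_raw W (Some (x1, y1)) (Some (x2, y2)) = Some (x3, y3) ->
  collinear x1 y1 x2 y2 x3 (- y3).
Proof.
move=> o1 o2; rewrite /add_raw /=.
case: (eqVneq x1 x2) => [x12 | x12] /=; last first.
  have dx : x2 - x1 != 0 by rewrite subr_eq0 eq_sym.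
  set l := _ / _ => -[<- <-]; exists l, (y1 - l * x1).
  have y2E : y2 = y1 + l * (x2 - x1) by rewrite /l; field.
  move: o1 o2; rewrite /on_curve /= !mul0r !addr0 => /eqP o1 /eqP o2.
  split; first by rewrite y2E; split; ring.
  clearbody l; subst y2.
  have bE : b = ((y1 + l * (x2 - x1)) ^+ 2 - y1 ^+ 2 - (x2 ^+ 3 - x1 ^+ 3)
    - a * (x2 ^+ 2 - x1 ^+ 2)) / (x2 - x1) by rewrite o1 o2; field.
  have cE : c = y1 ^+ 2 - (x1 ^+ 3 + a * x1 ^+ 2 + b * x1) by rewrite o1; ring.
  by rewrite cE bE; split; field.
subst x2; case: ifP => // /negbT n2; rewrite mul0r !subr0 in n2.
have [] := on_curve_same_abscissa o1 o2; first by rewrite /= mul0r !subr0.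
move=> ->; rewrite /= !mul0r !addr0 !subr0 => y0.
set l := _ / _ => -[<- <-]; exists l, (y1 - l * x1).
move: o1; rewrite /on_curve /= !mul0r !addr0 => /eqP o1.
split; first by split; ring.
have lE : l * (2 * y1) = 3 * x1 ^+ 2 + 2 * a * x1 + b by rewrite /l divfK.
clearbody l.
have bE : b = l * (2 * y1) - 3 * x1 ^+ 2 - 2 * a * x1 by rewrite lE; ring.
have cE : c = y1 ^+ 2 - (x1 ^+ 3 + a * x1 ^+ 2 + b * x1) by rewrite o1; ring.
by rewrite cE bE; split; ring.
Qed.

Lemma collinear_on_curve x1 y1 x2 y2 x3 y3 :
  collinear x1 y1 x2 y2 x3 y3 -> on_curve W (Some (x1, y1)).
Proof.
move=> [l [m [[-> _ _] [ea eb ec]]]]; apply/eqP => /=.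
by rewrite ea eb ec; ring.
Qed.

Hypotheses (two0 : (2 : K) != 0) (ns : nonsingular).

(** Collinearity is symmetric in the first two points, which settles every affine sum. *)
Lemma add_rawC P Q : on_curve W P -> on_curve W Q ->
  add_raw W P Q = add_raw W Q P.
Proof.
case: P Q => [[x1 y1]|] [[x2 y2]|] // o1 o2.
case e: (add_raw W _ _) => [[x3 y3]|].
  have /collinear_swap/(collinear_add two0 ns)-> := add_collinear o1 o2 e.
  by rewrite opprK.
by have -> := add_raw_eq_None e; rewrite /= !mul0r !subr0 opprK !eqxx.
Qed.

End Lines.

(** * Translation by the point (0, 0) of order 2 *)

Section Translation.
Variables (K : fieldType) (a b : K).
Hypotheses (two0 : (2 : K) != 0) (ns : nonsingular a b 0).

Local Notation W := (Weierstrass 0 a 0 b 0).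
Local Notation T := (Some (0, 0) : option (K * K)).

Let b0 : b != 0.
Proof.
have := ns (x := 0); rewrite !expr0n /= !mulr0 !addr0 add0r; exact.
Qed.

(** The line through the origin has intercept 0, so the formula for [b] reduces to the product of
    the two other abscissas. *)
Lemma add_origin x y : on_curve W (Some (x, y)) -> x != 0 ->
  collinear a b 0 x y 0 0 (b / x) (b * y / x ^+ 2).
Proof.
rewrite /on_curve /= !mul0r !addr0 => /eqP oxy x0; exists (y / x), 0.
split; first by split; field.
have aE : a = (y ^+ 2 - x ^+ 3 - b * x) / x ^+ 2 by rewrite oxy; field.
by rewrite aE; split; field.
Qed.

Lemma abscissa_eq0 y : on_curve W (Some (0, y)) -> y = 0.
Proof.
rewrite /on_curve /= !mul0r !mulr0 !expr0n /= !mulr0 !addr0 sqrf_eq0.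
by move/eqP.
Qed.

Lemma add_originE x y : on_curve W (Some (x, y)) -> x != 0 ->
  add_raw W (Some (x, y)) T = Some (b / x, - (b * y / x ^+ 2)).
Proof. by move=> o x0; exact/(collinear_add two0 ns)/add_origin. Qed.

Lemma origin_on_curve : on_curve W T.
Proof. by apply/eqP => /=; ring. Qed.

Lemma add_origin_origin : add_raw W T T = None.
Proof. by rewrite /= mulr0 !subr0 oppr0 !eqxx. Qed.

Lemma add_originK P : on_curve W P -> add_raw W (add_raw W P T) T = P.
Proof.
case: P => [[x y]|] oP; last exact: add_origin_origin.
have [x0 | x0] := eqVneq x 0.
  by subst x; rewrite (abscissa_eq0 oP) add_origin_origin.
rewrite add_originE // add_originE ?mulf_neq0 ?invr_neq0 //; last first.
  by rewrite -add_originE // add_raw_on_curve // origin_on_curve.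
by congr (Some (_, _)); field; rewrite ?x0 ?b0.
Qed.

(** Apart from degenerate positions, the points P + T, Q and - ((P + Q) + T) are shown to lie on an
    explicit line. *)
Lemma add_originA P Q : on_curve W P -> on_curve W Q ->
  add_raw W (add_raw W P T) Q = add_raw W (add_raw W P Q) T.
Proof.
have oT := origin_on_curve => oP oQ.
case: P oP => [[x1 y1]|] oP; last by rewrite (add_rawC two0 ns).
case: Q oQ => [[x2 y2]|] oQ; last by case: (add_raw W _ T) => [[]|].
have [x10 | x10] := eqVneq x1 0.
  subst x1; rewrite (abscissa_eq0 oP) (add_rawC two0 ns oT oQ) add_originK //.
  by rewrite add_origin_origin.
have [x20 | x20] := eqVneq x2 0.
  by subst x2; rewrite (abscissa_eq0 oQ).
rewrite add_originE //.
case e: (add_raw W (Some (x1, y1)) _) => [[x3 y3]|]; last first.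
  (* Here Q = - P, and the line through - P and T meets the curve again at P + T. *)
  have [-> ->] : x2 = x1 /\ y2 = - y1.
    by have := add_raw_eq_None e; rewrite /= mul0r !subr0 => -[].
  transitivity (Some (0 : K, - 0 : K)); last by rewrite oppr0.
  apply: (collinear_add two0 ns); do 2!apply: collinear_rot.
  by have := collinear_opp (add_origin oP x10); rewrite oppr0.
have := add_collinear oP oQ e.
move=> [l [m [[e1 e2 e3] [ea eb ec]]]].
(* If [m] is zero the line passes through T, which must be the third intersection; then P + Q = T
   and both sides are [None]. *)
have [m0 | m0] := eqVneq m 0.
  subst m.
  have x30 : x3 = 0.
    have /eqP : x1 * x2 * x3 = 0
      by rewrite -[LHS](subKr (0 ^+ 2)) -ec expr0n subr0.
    by rewrite !mulf_eq0 (negPf x10) (negPf x20) => /eqP.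
  have -> : y3 = 0 by apply/eqP; rewrite -oppr_eq0 e3 x30 mulr0 addr0.
  have bE : b = x1 * x2 by rewrite eb x30; ring.
  rewrite x30 add_origin_origin /add_raw /= !mul0r !subr0 ifT //.
  apply/andP; split; apply/eqP; rewrite bE; first by field.
  by rewrite e1 e2 !addr0; field.
have xxx : x1 * x2 * x3 = m ^+ 2 by apply/eqP; rewrite -subr_eq0 -oppr_eq0 opprB -ec.
have x30 : x3 != 0.
  by apply: contraNneq m0 => x30; rewrite -sqrf_eq0 -xxx x30 mulr0.
rewrite add_originE //; last by rewrite -e add_raw_on_curve.
apply: (collinear_add two0 ns).
have x3E : x3 = m ^+ 2 / (x1 * x2) by rewrite -xxx; field; rewrite x10 x20.
have y3E : y3 = - (l * x3 + m) by rewrite -e3 opprK.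
(* As c = 0, the squared intercept is the product of the abscissas b / x1, x2 and b / x3, that is (b
   x2 / m)^2 by [xxx]. Passing through [(x2, y2)] then fixes the slope. *)
exists (l + m / x2 - b / m), (b * x2 / m).
have aE := ea; have bE := eb; rewrite x3E in aE bE.
rewrite y3E e1 e2 x3E aE bE.
by split; split; field; rewrite ?x10 ?x20 ?m0.
Qed.


End Translation.

(** * Curves with full 2-torsion: translations and halving *)

Section CubicModel.
Variable K : fieldType.
Hypothesis two0 : (2 : K) != 0.

Section DistinctRoots.
Variables e1 e2 e3 : K.
Hypotheses (e12 : e1 != e2) (e13 : e1 != e3) (e23 : e2 != e3).

Local Notation W := (cubic_model e1 e2 e3).
Local Notation "P +% Q" := (add_raw W P Q) (at level 50, left associativity).
Implicit Types P Q T : option (K * K).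

Lemma cubic_nonsingular :
  nonsingular (e1 + e2 + e3) (e1 * e2 + e1 * e3 + e2 * e3) (e1 * e2 * e3).
Proof.
move=> x fx.
have -> : 3 * x ^+ 2 + 2 * (e1 + e2 + e3) * x + (e1 * e2 + e1 * e3 + e2 * e3)
  = (x + e1) * (x + e2) + (x + e1) * (x + e3) + (x + e2) * (x + e3) by ring.
have d12 : e1 - e2 != 0 by rewrite subr_eq0.
have d13 : e1 - e3 != 0 by rewrite subr_eq0.
have d23 : e2 - e3 != 0 by rewrite subr_eq0.
have /eqP : (x + e1) * (x + e2) * (x + e3) = 0 by rewrite -[RHS]fx; ring.
rewrite mulf_eq0 mulf_eq0 -orbA => /or3P[]; rewrite addr_eq0 => /eqP ->.
- have -> : (- e1 + e1) * (- e1 + e2) + (- e1 + e1) * (- e1 + e3)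
    + (- e1 + e2) * (- e1 + e3) = (e1 - e2) * (e1 - e3) by ring.
  exact: mulf_neq0.
- have -> : (- e2 + e1) * (- e2 + e2) + (- e2 + e1) * (- e2 + e3)
    + (- e2 + e2) * (- e2 + e3) = - ((e1 - e2) * (e2 - e3)) by ring.
  by rewrite oppr_eq0 mulf_neq0.
have -> : (- e3 + e1) * (- e3 + e2) + (- e3 + e1) * (- e3 + e3)
    + (- e3 + e2) * (- e3 + e3) = (e1 - e3) * (e2 - e3) by ring.
exact: mulf_neq0.
Qed.

Lemma cubic_addC P Q : on_curve W P -> on_curve W Q -> P +% Q = Q +% P.
Proof. exact/add_rawC/cubic_nonsingular. Qed.

(** The fragment of associativity that the construction uses. It also holds for [None], so that
    absent 2-torsion terms are handled uniformly. *)
Definition translation T := [/\ on_curve W T, T +% T = None &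
  forall P Q, on_curve W P -> on_curve W Q -> P +% T +% Q = P +% Q +% T].

Lemma translation_None : translation None.
Proof. by split=> // P Q _ _; case: P => [[? ?]|] //; case: (_ +% Q) => [[]|]. Qed.

Lemma translationK T P : translation T -> on_curve W P -> P +% T +% T = P.
Proof.
by move=> [oT TT tT] oP; rewrite (cubic_addC oP oT) -tT // TT.
Qed.

Lemma translation_root : translation (Some (- e1, 0)).
Proof.
(* Shifting the abscissa by [e1] moves the root to the origin, giving y^2 = x (x + p) (x + q). *)
pose p := e2 - e1; pose q := e3 - e1.
have ch : is_change 1 (- e1) 0 0 W (Weierstrass 0 (p + q) 0 (p * q) 0).
  by rewrite /p /q; split=> /=; ring.
have ns : nonsingular (p + q) (p * q) 0.
  move=> x fx; have := @cubic_nonsingular (x - e1).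
  have -> : (x - e1) ^+ 3 + (e1 + e2 + e3) * (x - e1) ^+ 2
    + (e1 * e2 + e1 * e3 + e2 * e3) * (x - e1) + e1 * e2 * e3 = 0.
    by rewrite -[RHS]fx /p /q; ring.
  by move=> /(_ erefl); congr (_ != 0); rewrite /p /q; ring.
have u0 : (1 : K) != 0 by apply: oner_neq0.
have TE : Some (- e1, 0) = change_vars 1 (- e1) 0 0 (Some (0, 0) : option (K * K)).
  by congr (Some (_, _)); ring.
have oT := origin_on_curve (p + q) (p * q).
have psiK := unchange_varsK (- e1) 0 0 u0.
have oncE := on_curve_change u0 ch; have addE := add_change u0 ch.
split; first by rewrite TE oncE.
  by rewrite TE -addE // add_origin_origin.
move=> P Q; rewrite -(psiK P) -(psiK Q) TE !oncE => oP oQ.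
by rewrite -!addE ?add_originA // add_raw_on_curve.
Qed.

End DistinctRoots.

Lemma doubling (e1 e2 e3 x y x' y' : K) : y != 0 ->
  on_curve (cubic_model e1 e2 e3) (Some (x, y)) ->
  add_raw (cubic_model e1 e2 e3) (Some (x, y)) (Some (x, y)) = Some (x', y') ->
  exists r1 r2 r3,
    [/\ x' + e1 = r1 ^+ 2, x' + e2 = r2 ^+ 2 & x' + e3 = r3 ^+ 2] /\
    [/\ x = x' + (r1 * r2 + r1 * r3 + r2 * r3),
        y = (r1 + r2) * (r1 + r3) * (r2 + r3) & y' = r1 * r2 * r3].
Proof.
move=> y0; rewrite on_curve_cubic_model => /eqP.
set p1 := x + e1; set p2 := x + e2; set p3 := x + e3 => oxy.
have : p1 * p2 * p3 != 0 by rewrite -oxy expf_neq0.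
rewrite !mulf_eq0 !negb_or => /andP[/andP[p10 p20] p30].
have yy : 2 * y != 0 by apply: mulf_neq0.
rewrite /add_raw eqxx /= mul0r !subr0 !addr0 ifF; last first.
  by apply/negP => /eqP h; case/negP: yy; rewrite mulr_natl mulr2n {1}h addNr.
move=> [<- <-].
have e1E : e1 = p1 - x by rewrite /p1; ring.
have e2E : e2 = p2 - x by rewrite /p2; ring.
(* Solving the curve equation for [e3] turns the remaining goals into identities of rational
   functions in x, y, p1, p2. *)
have e3E : e3 = y ^+ 2 / (p1 * p2) - x.
  by rewrite oxy /p3; field; rewrite p10 p20.
clearbody p1 p2 p3; rewrite e1E e2E e3E.
(* These are r_i = l - y / p_i with l the tangent slope, where y / p3 is written p1 p2 / y.
   Evaluating the cubic minus the square of the tangent at - e_i gives x' + e_i = (l - y /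
   p_i)^2. *)
exists ((y / p2 + p1 * p2 / y - y / p1) / 2).
exists ((y / p1 + p1 * p2 / y - y / p2) / 2).
exists ((y / p1 + y / p2 - p1 * p2 / y) / 2).
by split; split; field; rewrite ?p10 ?p20 ?y0 ?two0.
Qed.

(** * The embedding of Z/10 x Z/2 built from a 5-torsion point and two roots *)

Section TorsionTable.
Variables e1 e2 e3 : K.
Hypotheses (e12 : e1 != e2) (e13 : e1 != e3) (e23 : e2 != e3).

Local Notation W := (cubic_model e1 e2 e3).
Local Notation "P +% Q" := (add_raw W P Q) (at level 50, left associativity).
Local Notation collinearW := (collinear
  (e1 + e2 + e3) (e1 * e2 + e1 * e3 + e2 * e3) (e1 * e2 * e3)).

Variables xR yR xQ yQ : K.
Hypotheses (RRQ : collinearW xR yR xR yR xQ (- yQ))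
  (QQR : collinearW xQ yQ xQ yQ xR yR).

(** The multiples of R: the two hypotheses say 2 R = Q and 2 Q = - R, whence 3 R = - Q and 4 R = -
    R. *)
Let five n := nth None [:: None; Some (xR, yR); Some (xQ, yQ);
  Some (xQ, - yQ); Some (xR, - yR)] (n %% 5)%N.

Let five_on n : on_curve W (five n).
Proof.
have oR := collinear_on_curve RRQ; have oQ := collinear_on_curve QQR.
have oR' := collinear_on_curve (collinear_opp RRQ).
have oQ' := collinear_on_curve (collinear_opp QQR).
by rewrite /five; case: (n %% 5)%N => [|[|[|[|[|[]]]]]].
Qed.

(** Of the 25 sums, 13 involve [None] or opposite points. The other 12 are the rotations of the two
    tangents and of their opposites. *)
Let fiveD m n : five (m + n) = five m +% five n.
Proof.
have sum x1 y1 x2 y2 x3 y3 : collinearW x1 y1 x2 y2 x3 y3 ->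
    Some (x1, y1) +% Some (x2, y2) = Some (x3, - y3).
  exact: (collinear_add two0 (cubic_nonsingular e12 e13 e23)).
have RRQ' := collinear_opp RRQ; have QQR' := collinear_opp QQR.
have RR := sum _ _ _ _ _ _ RRQ.
have RQ := sum _ _ _ _ _ _ (collinear_rot RRQ).
have QR := sum _ _ _ _ _ _ (collinear_rot (collinear_rot RRQ)).
have RR' := sum _ _ _ _ _ _ RRQ'.
have RQ' := sum _ _ _ _ _ _ (collinear_rot RRQ').
have QR' := sum _ _ _ _ _ _ (collinear_rot (collinear_rot RRQ')).
have QQ := sum _ _ _ _ _ _ QQR.
have QR2 := sum _ _ _ _ _ _ (collinear_rot QQR).
have RQ2 := sum _ _ _ _ _ _ (collinear_rot (collinear_rot QQR)).
have QQ' := sum _ _ _ _ _ _ QQR'.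
have QR2' := sum _ _ _ _ _ _ (collinear_rot QQR').
have RQ2' := sum _ _ _ _ _ _ (collinear_rot (collinear_rot QQR')).
have PN x y : Some (x, y) +% Some (x, - y) = None.
  by rewrite /= mul0r !subr0 !eqxx.
have NP x y : Some (x, - y) +% Some (x, y) = None.
  by rewrite /= mul0r !subr0 opprK !eqxx.
have P0 P : P +% None = P by case: P => [[]|].
have P0' P : None +% P = P by [].
rewrite /five -(modnDm m n 5).
have: (m %% 5 < 5)%N by rewrite ltn_mod.
have: (n %% 5 < 5)%N by rewrite ltn_mod.
rewrite !opprK in RR RQ QR RR' RQ' QR' QQ QR2 RQ2 QQ' QR2' RQ2'.
move: RR RQ QR RR' RQ' QR' QQ QR2 RQ2 QQ' QR2' RQ2' PN NP P0 P0'.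
(* Abstracting the law keeps [/=] from unfolding it. *)
move: (add_raw W) => add RR RQ QR RR' RQ' QR' QQ QR2 RQ2 QQ' QR2' RQ2' PN NP P0 P0'.
move: (m %% 5)%N (n %% 5)%N => [|[|[|[|[|i]]]]] [|[|[|[|[|j]]]]] // _ _ /=.
all: by rewrite ?P0 ?P0' ?PN ?NP ?RR ?RQ ?QR ?RR' ?RQ' ?QR' ?QQ ?QR2 ?RQ2 ?QQ' ?QR2' ?RQ2'.
Qed.

(** Chinese remainders: n in Z/10 acts as n R, read modulo 5, plus n times [(- e1, 0)], read modulo
    2. *)
Definition torsion_map (g : 'Z_10 * 'Z_2) : option (K * K) :=
  five (val g.1) +% (if odd (val g.1) then Some (- e1, 0) else None)
    +% (if odd (val g.2) then Some (- e2, 0) else None).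

Lemma torsion_map_embedding : embedding W torsion_map.
Proof.
have t1 b : translation e1 e2 e3 (if b then Some (- e1, 0) else None).
  by case: b; [exact: (translation_root e12 e13 e23) | exact: translation_None].
have t2 b : translation e1 e2 e3 (if b then Some (- e2, 0) else None).
  have e21 : e2 != e1 by rewrite eq_sym.
  case: b; last exact: translation_None.
  have := translation_root e21 e23 e13; rewrite /translation.
  by have -> : cubic_model e2 e1 e3 = W by congr Weierstrass; ring.
have on_t1 b := let: And3 o _ _ := t1 b in o.
have on_t2 b := let: And3 o _ _ := t2 b in o.
have tor T b c P : translation e1 e2 e3 T -> on_curve W P ->
  P +% (if b then T else None) +% (if c then T else None) =
  P +% (if b (+) c then T else None).
  move=> tT oP; have oPT := add_raw_on_curve oP (let: And3 o _ _ := tT in o).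
  case: b c => [] [] /=; first by rewrite (translationK _ _ _ tT) //; case: (P) => [[]|].
  - by case: (P +% T) => [[]|].
  - by case: (P) => [[]|].
  by case: (P) => [[]|].
have onE g : on_curve W (torsion_map g) by rewrite !add_raw_on_curve.
have homE g h : torsion_map (g + h) = torsion_map g +% torsion_map h.
  case: g h => [n k] [m l]; rewrite /torsion_map /=.
  have -> : five (((n + m) %% 10)%N) = five (n + m).
    by rewrite /five modn_dvdm.
  have oddm i : odd (i %% 10) = odd i.
    by rewrite [in RHS](divn_eq i 10) oddD oddM andbF.
  have oddm2 i : odd (i %% 2) = odd i by rewrite modn2 oddb.
  rewrite oddm oddm2 !oddD addnC fiveD.
  set A := five n; set B := five m.
  have oA : on_curve W A := five_on n; have oB : on_curve W B := five_on m.
  have [oS _ tS] := t1 (odd n); have [oS' _ tS'] := t1 (odd m).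
  have [oU _ tU] := t2 (odd k); have [oU' _ tU'] := t2 (odd l).
  (* The 2-torsion terms of the left summand are pulled out, commutativity exchanges the summands,
     and those of the other follow. Each root then occurs in two adjacent terms, which [tor]
     merges. *)
  rewrite tU ?add_raw_on_curve // tS ?add_raw_on_curve //.
  rewrite [A +% _](cubic_addC e12 e13 e23) ?add_raw_on_curve //.
  rewrite tU' ?add_raw_on_curve // tS' ?add_raw_on_curve //.
  rewrite tU' ?add_raw_on_curve //.
  by rewrite !(tor _ _ _ _ (t1 true), tor _ _ _ _ (t2 true)) ?add_raw_on_curve //
    [odd m (+) _]addbC [odd l (+) _]addbC.
split=> // g h gh.
have f0 : torsion_map 0 = None by [].
(* Doubling [p] removes both 2-torsion terms, so its first component is divisible by 5. Besides 0
   only T1, T2 and T1 + T2 remain as images, with T1 = (- e1, 0) and T2 = (- e2, 0), and the last is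
   not [None] because [e1] and [e2] differ. *)
have ker p : torsion_map p = None -> p = 0.
  move=> p0; have pp0 : torsion_map (p + p) = None by rewrite homE p0.
  have T12 : Some (- e1, 0) +% Some (- e2, 0) <> None.
    by move=> /add_raw_eq_None[/oppr_inj e21 _]; case/eqP: e12.
  case: p p0 pp0 => [[n ln] [k lk]] p0 pp0.
  case: k n lk ln p0 pp0 => [|[|//]] [|[|[|[|[|[|[|[|[|[|//]]]]]]]]]] lk ln // _ _.
  by congr pair; apply: val_inj.
apply/eqP; rewrite -subr_eq0; apply/eqP/ker.
by rewrite homE gh -homE subrr.
Qed.
End TorsionTable.
End CubicModel.

(** * From the parameters to the torsion subgroup, and normal form for full 2-torsion *)

Section Parametrization.
Variable K : fieldType.
Hypothesis two0 : (2 : K) != 0.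

Let four0 : (4 : K) != 0.
Proof. by rewrite (_ : 4 = 2 * 2) ?mulf_neq0 //; ring. Qed.

(** The converse of [doubling] for x' = 0, up to the sign of the ordinates. The point lies on the
    line because s1 s2 - s3 = (r1 + r2) (r1 + r3) (r2 + r3) for the elementary symmetric s_i. *)
Lemma tangent_line (r1 r2 r3 : K) :
  let x := r1 * r2 + r1 * r3 + r2 * r3 in
  let y := - ((r1 + r2) * (r1 + r3) * (r2 + r3)) in
  collinear (r1 ^+ 2 + r2 ^+ 2 + r3 ^+ 2)
    (r1 ^+ 2 * r2 ^+ 2 + r1 ^+ 2 * r3 ^+ 2 + r2 ^+ 2 * r3 ^+ 2)
    (r1 ^+ 2 * r2 ^+ 2 * r3 ^+ 2) x y x y 0 (r1 * r2 * r3).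
Proof.
by exists (- (r1 + r2 + r3)), (r1 * r2 * r3); split; split; ring.
Qed.

Lemma E5_embedding (a1 a2 a3 : K) :
  uniq [:: a1; - a1; a2; - a2; a3; - a3] ->
  a1 ^+ 3 + a2 ^+ 3 + a3 ^+ 3 - a1 ^+ 2 * a2 - a1 * a2 ^+ 2 - a2 ^+ 2 * a3
    - a2 * a3 ^+ 2 - a1 ^+ 2 * a3 - a1 * a3 ^+ 2 - 2 * a1 * a2 * a3 = 0 ->
  exists f : 'Z_10 * 'Z_2 -> _, embedding (E5 a1 a2 a3) f.
Proof.
rewrite /= !inE !negb_or.
case/andP=> /and5P[n1 d12 d12' d13 d13'].
case/andP=> _ /andP[/and3P[n2 d23 d23'] /andP[_ /andP[n3 _]]] F0.
have nz (a : K) : a != - a -> a != 0 by apply: contraNneq => ->; rewrite oppr0.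
have sqr_sub (b c d : K) : b != c -> b != - c -> d != - d ->
    (b ^+ 2 - c ^+ 2) * d ^+ 2 != 0.
  move=> bc bc' dd; rewrite subr_sqr; apply: mulf_neq0; last exact/expf_neq0/nz.
  by rewrite mulf_neq0 ?subr_eq0 ?addr_eq0.
set r1 := beta1 a1 a2 a3 / 2; set r2 := beta2 a1 a2 a3 / 2.
set r3 := beta3 a1 a2 a3 / 2.
have r12 : r1 + r2 = a3 ^+ 2 by rewrite /r1 /r2 /beta1 /beta2; field.
have r13 : r1 + r3 = a2 ^+ 2 by rewrite /r1 /r3 /beta1 /beta3; field.
have r23 : r2 + r3 = a1 ^+ 2 by rewrite /r2 /r3 /beta2 /beta3; field.
have -> : E5 a1 a2 a3 = cubic_model (r1 ^+ 2) (r2 ^+ 2) (r3 ^+ 2).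
  by congr cubic_model; rewrite /r1 /r2 /r3; field; rewrite ?four0 ?two0.
(* Each r_i^2 - r_j^2 = (r_i + r_j) (r_i - r_j) equals a_k^2 (a_j^2 - a_i^2). *)
have ne12 : r1 ^+ 2 != r2 ^+ 2.
  rewrite -subr_eq0 -oppr_eq0; have := sqr_sub _ _ _ d12 d12' n3.
  by rewrite -r12 -r13 -r23; congr (_ != 0); ring.
have ne13 : r1 ^+ 2 != r3 ^+ 2.
  rewrite -subr_eq0 -oppr_eq0; have := sqr_sub _ _ _ d13 d13' n2.
  by rewrite -r12 -r13 -r23; congr (_ != 0); ring.
have ne23 : r2 ^+ 2 != r3 ^+ 2.
  rewrite -subr_eq0 -oppr_eq0; have := sqr_sub _ _ _ d23 d23' n1.
  by rewrite -r12 -r13 -r23; congr (_ != 0); ring.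
set X := r1 * r2 + r1 * r3 + r2 * r3.
(* With F the cubic relation, 4 X + (a1 + a2 + a3) F = - 4 a1 a2 a3 (a1 + a2 + a3). *)
have XE : X = - (a1 * a2 * a3 * (a1 + a2 + a3)).
  apply: (mulfI four0); rewrite -[LHS]addr0 -(mulr0 (a1 + a2 + a3)) -F0.
  by rewrite /X /r1 /r2 /r3 /beta1 /beta2 /beta3; field.
have yRE : r1 * r2 * r3 = - (a1 * a2 * a3 * ((a1 + a2) * (a1 + a3) * (a2 + a3))).
  apply: (mulfI four0); apply: (mulfI two0).
  (* [G] is the cofactor of the cubic relation in eight times the difference of the two sides. *)
  pose G := a1 ^+ 3 + a2 ^+ 3 + a3 ^+ 3 + a1 ^+ 2 * a2 + a1 * a2 ^+ 2
    + a2 ^+ 2 * a3 + a2 * a3 ^+ 2 + a1 ^+ 2 * a3 + a1 * a3 ^+ 2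
    + 4 * a1 * a2 * a3.
  rewrite -[LHS]addr0 -(mulr0 G) -F0.
  by rewrite /G /r1 /r2 /r3 /beta1 /beta2 /beta3; field.
have e1E : r1 ^+ 2 = (a2 * a3) ^+ 2 - X by rewrite (exprMn _ a2) -r12 -r13 /X; ring.
have e2E : r2 ^+ 2 = (a1 * a3) ^+ 2 - X by rewrite (exprMn _ a1) -r12 -r23 /X; ring.
have e3E : r3 ^+ 2 = (a1 * a2) ^+ 2 - X by rewrite (exprMn _ a1) -r13 -r23 /X; ring.
(* Here R = (0, r1 r2 r3) and Q has abscissa [X]; this is 2 Q = - R. *)
have QQR := tangent_line r1 r2 r3; rewrite /= r12 r13 r23 -/X in QQR.
eexists; apply: (torsion_map_embedding two0 ne12 ne13 ne23 _ QQR).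
rewrite opprK yRE e1E e2E e3E XE.
(* The tangent at R: its intercept is y(R) since x(R) = 0, and its slope is minus the sum of the
   square roots a_j a_k of x(Q) + e_i. *)
exists (- (a1 * a2 + a1 * a3 + a2 * a3)),
  (- (a1 * a2 * a3 * ((a1 + a2) * (a1 + a3) * (a2 + a3)))).
by split; split; ring.
Qed.

(** First and second divided differences of the cubic give [a]; then [b] and [c] follow. *)
Lemma cubic_vieta (x1 x2 x3 a b c : K) : x1 != x2 -> x1 != x3 -> x2 != x3 ->
  x1 ^+ 3 + a * x1 ^+ 2 + b * x1 + c = 0 ->
  x2 ^+ 3 + a * x2 ^+ 2 + b * x2 + c = 0 ->
  x3 ^+ 3 + a * x3 ^+ 2 + b * x3 + c = 0 ->
  [/\ a = - x1 - x2 - x3, b = x1 * x2 + x1 * x3 + x2 * x3 & c = - (x1 * x2 * x3)].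
Proof.
rewrite -!(subr_eq0 _ x2) -!(subr_eq0 _ x3) => d12 d13 d23 h1 h2 h3.
have q12 : x1 ^+ 2 + x1 * x2 + x2 ^+ 2 + a * (x1 + x2) + b = 0.
  apply: (mulfI d12); rewrite mulr0 -[RHS](subrr 0) -{1}h1 -h2; ring.
have q13 : x1 ^+ 2 + x1 * x3 + x3 ^+ 2 + a * (x1 + x3) + b = 0.
  apply: (mulfI d13); rewrite mulr0 -[RHS](subrr 0) -{1}h1 -h3; ring.
have s : x1 + x2 + x3 + a = 0.
  apply: (mulfI d23); rewrite mulr0 -[RHS](subrr 0) -{1}q12 -q13; ring.
have aE : a = - x1 - x2 - x3 by rewrite -[LHS]subr0 -s; ring.
have bE : b = x1 * x2 + x1 * x3 + x2 * x3.
  by rewrite -[LHS]subr0 -q12 aE; ring.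
by split=> //; rewrite -[LHS]subr0 -h1 aE bE; ring.
Qed.

(** A point equal to its opposite has y = - (c1 x + c3) / 2, so distinct ones have distinct
    abscissas. These are the roots of the cubic obtained by completing the square in y, which is the
    change of variables used. *)
Lemma isomorphic_cubic_model (W : weierstrass K) (x1 y1 x2 y2 x3 y3 : K) :
  let P1 := Some (x1, y1) in let P2 := Some (x2, y2) in
  let P3 := Some (x3, y3) in
  [/\ on_curve W P1, on_curve W P2 & on_curve W P3] ->
  [/\ P1 = opp_raw W P1, P2 = opp_raw W P2 & P3 = opp_raw W P3] ->
  [/\ P1 <> P2, P1 <> P3 & P2 <> P3] ->
  exists e1 e2 e3, [/\ e1 != e2, e1 != e3 & e2 != e3] /\
    isomorphic W (cubic_model e1 e2 e3).
Proof.
move=> P1 P2 P3 [o1 o2 o3] [t1 t2 t3] [n12 n13 n23].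
have yE x y : Some (x, y) = opp_raw W (Some (x, y)) ->
    y = - (c1 W * x + c3 W) / 2.
  by move=> [e]; apply: (mulfI two0); rewrite mulr_natl mulr2n {2}e; field.
have rootE x y : on_curve W (Some (x, y)) ->
    Some (x, y) = opp_raw W (Some (x, y)) ->
    x ^+ 3 + (c2 W + c1 W ^+ 2 / 4) * x ^+ 2 + (c4 W + c1 W * c3 W / 2) * x
    + (c6 W + c3 W ^+ 2 / 4) = 0.
  move=> /eqP o /yE y_eq; transitivity
    (x ^+ 3 + c2 W * x ^+ 2 + c4 W * x + c6 W
     - (y ^+ 2 + c1 W * x * y + c3 W * y)); last by rewrite o subrr.
  by rewrite y_eq; field; rewrite ?four0 ?two0.
have ne x y x' y' : Some (x, y) = opp_raw W (Some (x, y)) ->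
    Some (x', y') = opp_raw W (Some (x', y')) ->
    Some (x, y) <> Some (x', y') -> x != x'.
  by move=> /yE-> /yE-> n; apply/eqP => e; case: n; rewrite e.
have d12 := ne _ _ _ _ t1 t2 n12; have d13 := ne _ _ _ _ t1 t3 n13.
have d23 := ne _ _ _ _ t2 t3 n23.
have [aE bE cE] := cubic_vieta d12 d13 d23 (rootE _ _ o1 t1) (rootE _ _ o2 t2)
  (rootE _ _ o3 t3).
exists (- x1), (- x2), (- x3); rewrite !(inj_eq oppr_inj); split=> //.
exists 1, 0, (- c1 W / 2), (- c3 W / 2); split; first exact: oner_neq0.
split=> /=; rewrite ?expr1n ?mul1r; first by field.
- by rewrite -aE; field; rewrite ?four0 ?two0.
- by field.
- transitivity (x1 * x2 + x1 * x3 + x2 * x3); first by ring.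
  by rewrite -bE; field; rewrite ?four0 ?two0.
transitivity (- (x1 * x2 * x3)); first by ring.
by rewrite -cE; field; rewrite ?four0 ?two0.
Qed.

End Parametrization.

(** * From a point of order 5 to the parameters *)

Lemma five_torsion_parameters (K : fieldType) (e1 e2 e3 xR yR xQ yQ : K) :
  let W := cubic_model e1 e2 e3 in
  let R := Some (xR, yR) in let Q := Some (xQ, yQ) in
  (2 : K) != 0 -> [/\ e1 != e2, e1 != e3 & e2 != e3] ->
  yR != 0 -> yQ != 0 -> xQ != xR -> on_curve W R -> on_curve W Q ->
  add_raw W R R = Q -> add_raw W Q Q = opp_raw W R ->
  exists a1 a2 a3 : K,
    uniq [:: a1; - a1; a2; - a2; a3; - a3] /\
    [/\ beta1 a1 a2 a3 != 0, beta2 a1 a2 a3 != 0 & beta3 a1 a2 a3 != 0] /\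
    a1 ^+ 3 + a2 ^+ 3 + a3 ^+ 3 - a1 ^+ 2 * a2 - a1 * a2 ^+ 2 - a2 ^+ 2 * a3
      - a2 * a3 ^+ 2 - a1 ^+ 2 * a3 - a1 * a3 ^+ 2 - 2 * a1 * a2 * a3 = 0 /\
    (a1 + a2 + a3) * (a1 - a2 - a3) * (a1 + a2 - a3) * (a1 - a2 + a3) != 0 /\
    isomorphic W (E5 a1 a2 a3).
Proof.
move=> W R Q two0 [n12 n13 n23] yR0 yQ0 xQR oR oQ RR QQ.
have [s1 [s2 [s3 [[q1 q2 q3] [xs ys zs]]]]] := doubling two0 yR0 oR RR.
have QQ' : add_raw W Q Q = Some (xR, - yR) by rewrite QQ /= mul0r !subr0.
have [r1 [r2 [r3 [[p1 p2 p3] [xr yr zr]]]]] := doubling two0 yQ0 oQ QQ'.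
have e1E : e1 = r1 ^+ 2 - xR by rewrite -p1; ring.
have e2E : e2 = r2 ^+ 2 - xR by rewrite -p2; ring.
have e3E : e3 = r3 ^+ 2 - xR by rewrite -p3; ring.
have s1E : s1 ^+ 2 = (r1 + r2) * (r1 + r3) by rewrite -q1 xr e1E; ring.
have s2E : s2 ^+ 2 = (r1 + r2) * (r2 + r3) by rewrite -q2 xr e2E; ring.
have s3E : s3 ^+ 2 = (r1 + r3) * (r2 + r3) by rewrite -q3 xr e3E; ring.
have s0 : s1 * s2 * s3 != 0 by rewrite -zs.
have r0 : r1 * r2 * r3 != 0 by rewrite -zr oppr_eq0.
move: s0 r0; rewrite !mulf_eq0 !negb_or.
move=> /andP[/andP[s10 s20] s30] /andP[/andP[r10 r20] r30].
have a1E : (s2 * s3) ^+ 2 = yQ * (r2 + r3) by rewrite exprMn s2E s3E yr; ring.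
have a2E : (s1 * s3) ^+ 2 = yQ * (r1 + r3) by rewrite exprMn s1E s3E yr; ring.
have a3E : (s1 * s2) ^+ 2 = yQ * (r1 + r2) by rewrite exprMn s1E s2E yr; ring.
set a1 := s2 * s3 in a1E *; set a2 := s1 * s3 in a2E *.
set a3 := s1 * s2 in a3E *; exists a1, a2, a3.
have a10 : a1 != 0 by apply: mulf_neq0.
have a20 : a2 != 0 by apply: mulf_neq0.
have a30 : a3 != 0 by apply: mulf_neq0.
have b1E : beta1 a1 a2 a3 = 2 * yQ * r1 by rewrite /beta1 a1E a2E a3E; ring.
have b2E : beta2 a1 a2 a3 = 2 * yQ * r2 by rewrite /beta2 a1E a2E a3E; ring.
have b3E : beta3 a1 a2 a3 = 2 * yQ * r3 by rewrite /beta3 a1E a2E a3E; ring.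
have rne (e e' r r' : K) : e != e' -> e = r ^+ 2 - xR -> e' = r' ^+ 2 - xR ->
    r != r'.
  by move=> n ee ee'; apply: contraNneq n => rr; rewrite ee ee' rr.
(* The difference of the squares is yQ (r - r'). *)
have ane (a a' r r' t : K) : a ^+ 2 = yQ * (r + t) -> a' ^+ 2 = yQ * (r' + t) ->
    r != r' -> (a != a') && (a != - a').
  move=> aa aa' n; rewrite -negb_or -eqf_sqr aa aa'.
  by rewrite (inj_eq (mulfI yQ0)) (inj_eq (addIr t)).
have aN (a : K) : a != 0 -> a != - a.
  by move=> a0; rewrite -addr_eq0 -mulr2n -mulr_natl mulf_neq0.
have r12 := rne _ _ _ _ n12 e1E e2E; have r13 := rne _ _ _ _ n13 e1E e3E.
have r23 := rne _ _ _ _ n23 e2E e3E.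
(* The two doublings express xR - xQ once by the [s] and once by the [r]. *)
have sum0 : (r1 * r2 + r1 * r3 + r2 * r3) + (s1 * s2 + s1 * s3 + s2 * s3) = 0.
  by apply: (addrI xR); rewrite addrA -xr -xs addr0.
have sr0 : r1 * r2 + r1 * r3 + r2 * r3 != 0.
  by apply: contraNneq xQR => e; rewrite xr e addr0.
have ssE : yQ ^+ 2 * (s1 * s2 + s1 * s3 + s2 * s3)
    = a1 * a2 * a3 * (a1 + a2 + a3).
  by rewrite zs /a1 /a2 /a3; ring.
(* Heron's polynomial depends only on the a_k^2 = yQ (r_i + r_j). Its nonvanishing thus amounts to
   [xQ != xR]. *)
have heron : (a1 + a2 + a3) * (a1 - a2 - a3) * (a1 + a2 - a3) * (a1 - a2 + a3)
    = - (4 * yQ ^+ 2 * (r1 * r2 + r1 * r3 + r2 * r3)).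
  transitivity (a1 ^+ 2 ^+ 2 + a2 ^+ 2 ^+ 2 + a3 ^+ 2 ^+ 2
    - 2 * (a1 ^+ 2 * a2 ^+ 2 + a1 ^+ 2 * a3 ^+ 2 + a2 ^+ 2 * a3 ^+ 2)).
    by ring.
  by rewrite a1E a2E a3E; ring.
have four0 : (4 : K) != 0 by rewrite (_ : 4 = 2 * 2) ?mulf_neq0 //; ring.
have heron0 : (a1 + a2 + a3) * (a1 - a2 - a3) * (a1 + a2 - a3) * (a1 - a2 + a3)
    != 0.
  by rewrite heron oppr_eq0 !mulf_neq0.
split; last split; last split; last split=> //.
- have m12 : (a1 != a2) && (a1 != - a2).
    by apply: (ane _ _ r2 r1 r3); rewrite // 1?eq_sym // addrC.
  have m13 : (a1 != a3) && (a1 != - a3).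
    by apply: (ane _ _ r3 r1 r2); rewrite 1?eq_sym // 1?addrC // [r2 + _]addrC.
  have m23 : (a2 != a3) && (a2 != - a3).
    by apply: (ane _ _ r3 r2 r1); rewrite 1?eq_sym // addrC.
  case/andP: m12 m13 m23 => m12 m12' /andP[m13 m13'] /andP[m23 m23'].
  rewrite /= !inE !negb_or !(inj_eq oppr_inj) !eqr_oppLR.
  by rewrite m12 m12' m13 m13' m23 m23' !aN.
- by rewrite b1E b2E b3E !mulf_neq0.
- have sum0' : a1 + a2 + a3 != 0.
    by move: heron0; rewrite !mulf_eq0 !negb_or => /andP[/andP[/andP[]]].
  (* Heron's product minus 4 a1 a2 a3 (a1 + a2 + a3) is a1 + a2 + a3 times the cubic, and it
     vanishes by [heron], [ssE] and [sum0]. *)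
  apply: (mulfI sum0'); rewrite mulr0.
  rewrite -(mulr0 (- (4 * yQ ^+ 2))) -sum0.
  transitivity ((a1 + a2 + a3) * (a1 - a2 - a3) * (a1 + a2 - a3) * (a1 - a2 + a3)
    - 4 * (a1 * a2 * a3 * (a1 + a2 + a3))); first by ring.
  by rewrite heron -ssE; ring.
(* Translation brings R to abscissa 0, and scaling by yQ turns r_i^2 into (yQ r_i)^2 = beta_i^2 /
   4. *)
exists yQ^-1, xR, 0, 0; split; first by rewrite invr_eq0.
rewrite /W /E5 b1E b2E b3E e1E e2E e3E.
by split=> /=; field; rewrite ?four0 ?yQ0.
Qed.

Theorem theorem8p4 (K : fieldType) (charK : 2%N \notin [pchar K])
    (E : ellipticCurve K) :
  contains_subgroup_isomorphic_to E ('Z_10 * 'Z_2)%type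
  <->
  exists a1 a2 a3 : K,
    uniq [:: a1; - a1; a2; - a2; a3; - a3] /\
    [/\ beta1 a1 a2 a3 != 0, beta2 a1 a2 a3 != 0 & beta3 a1 a2 a3 != 0] /\
    a1 ^+ 3 + a2 ^+ 3 + a3 ^+ 3 - a1 ^+ 2 * a2 - a1 * a2 ^+ 2 - a2 ^+ 2 * a3
      - a2 * a3 ^+ 2 - a1 ^+ 2 * a3 - a1 * a3 ^+ 2 - 2 * a1 * a2 * a3 = 0 /\
    (a1 + a2 + a3) * (a1 - a2 - a3) * (a1 + a2 - a3) * (a1 - a2 + a3) != 0 /\
    isomorphic E (E5 a1 a2 a3).
Proof.
have two0 : (2 : K) != 0 by apply: contraNneq charK => e; rewrite inE /= e eqxx.
rewrite contains_subgroupP; split; last first.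
  move=> [a1 [a2 [a3 [u [_ [F0 [_ iso]]]]]]].
  by rewrite (embedding_isomorphic _ iso); apply: E5_embedding.
move=> [f emb].
have [e1 [e2 [e3 [ne iso]]]] : exists e1 e2 e3, [/\ e1 != e2, e1 != e3 & e2 != e3]
    /\ isomorphic E (cubic_model e1 e2 e3).
  have [finj fon _] := emb.
  (* The three elements of order 2, whose images provide the full 2-torsion. *)
  pose t1 : 'Z_10 * 'Z_2 := (5%:R, 0); pose t2 : 'Z_10 * 'Z_2 := (0, 1).
  pose t3 : 'Z_10 * 'Z_2 := (5%:R, 1).
  have fN t : - t = t -> f t = opp_raw E (f t).
    by move=> tt; rewrite -(embeddingN _ emb) tt.
  have f0 t : f t = None -> t = 0.
    by move=> ft; apply: finj; rewrite ft (embedding0 emb).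
  case e1: (f t1) (fon t1) (fN t1) => [[x1 y1]|] o1 h1; last first.
    by have := f0 _ e1.
  case e2: (f t2) (fon t2) (fN t2) => [[x2 y2]|] o2 h2; last first.
    by have := f0 _ e2.
  case e3: (f t3) (fon t3) (fN t3) => [[x3 y3]|] o3 h3; last first.
    by have := f0 _ e3.
  apply: (isomorphic_cubic_model two0 (And3 o1 o2 o3)).
    by split; [apply: h1 | apply: h2 | apply: h3]; congr pair; apply: val_inj.
  by split; rewrite -?e1 -?e2 -?e3 => /finj.
have [g [ginj gon gadd]] : exists g : 'Z_10 * 'Z_2 -> _, embedding
    (cubic_model e1 e2 e3) g.
  by rewrite -(embedding_isomorphic _ iso); exists f.
have emg : embedding (cubic_model e1 e2 e3) g by [].
(* An element of order 5, so 4 r = - r: the images R of r and Q of 2 r satisfy 2 R = Q and 2 Q = -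
   R. *)
pose r : 'Z_10 * 'Z_2 := (2%:R, 0).
have g0 t : g t = None -> t = 0.
  by move=> gt; apply: ginj; rewrite gt (embedding0 emg).
have gE : g (r *+ 4) = opp_raw (cubic_model e1 e2 e3) (g r).
  by rewrite -(embeddingN _ emg); congr g; congr pair; apply: val_inj.
case eR: (g r) => [[xR yR]|]; last by have := g0 _ eR.
case eQ: (g (r *+ 2)) => [[xQ yQ]|]; last by have := g0 _ eQ.
have oR := gon r; have oQ := gon (r *+ 2); rewrite eR in oR; rewrite eQ in oQ.
have RR := gadd r r; have QQ := gadd (r *+ 2) (r *+ 2).
rewrite -mulr2n eR eQ in RR; rewrite -mulrnDr gE eR eQ in QQ.
have yR0 : yR != 0.
  apply/negP => /eqP yR0; suff /ginj : g (r *+ 4) = g r by [].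
  by rewrite gE eR yR0 /= mul0r !subr0 oppr0.
have yQ0 : yQ != 0.
  apply/negP => /eqP yQ0; move: QQ.
  by rewrite yQ0 /= !mul0r !subr0 oppr0 !eqxx.
(* Equal abscissas would force Q = R or Q = - R, that is 2 r = r or 2 r = 4 r. *)
have xQR : xQ != xR.
  apply/negP => /eqP xQR.
  move: oR oQ; rewrite !on_curve_cubic_model xQR => /eqP <-.
  rewrite eqf_sqr => /orP[] /eqP yE.
    by suff /ginj : g (r *+ 2) = g r by []; rewrite eR eQ xQR yE.
  suff /ginj : g (r *+ 2) = g (r *+ 4) by [].
  by rewrite gE eR eQ xQR yE /= mul0r !subr0.
have [a1 [a2 [a3 [u [b [F0 [h iso']]]]]]] :=
  five_torsion_parameters two0 ne yR0 yQ0 xQR oR oQ (esym RR) (esym QQ).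
by exists a1, a2, a3; do !split=> //; apply: isomorphic_trans iso'.
Qed.
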